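(* Let $\mathcal{T}$ be an associative conformal algebra, $\mathcal{U}$ a conformal $\mathcal{T}$-bimodule, $H$ a Hochschild $2$-cocycle of $\mathcal{T}$ with coefficients in $\mathcal{U}$, and $R:\mathcal{U}\to\mathcal{T}$ a conformal $H$-twisted Rota-Baxter operator. Then the maps $\mathfrak{l}^R_\lambda:\mathcal{U}\otimes\mathcal{T}\to\mathcal{T}[\lambda]$ and $\mathfrak{r}^R_\lambda:\mathcal{T}\otimes\mathcal{U}\to\mathcal{T}[\lambda]$ given, for $u\in\mathcal{U}$ and $p\in\mathcal{T}$, by $$\mathfrak{l}^R_\lambda(u,p)=R(u)_\lambda p-R\big(u_\lambda p+H_\lambda(R(u),p)\big),\qquad \mathfrak{r}^R_\lambda(p,u)=p_\lambda R(u)-R\big(p_\lambda u+H_\lambda(p,R(u))\big)$$ define a conformal $(\mathcal{U},*_\lambda)$-bimodule structure on $\mathcal{T}$ (with left action $\mathfrak{l}^R$ and right action $\mathfrak{r}^R$), where $(\mathcal{U},*_\lambda)$ is the associative conformal algebra with product $u*_\lambda v=u_\lambda R(v)+R(u)_\lambda v+H_\lambda(R(u),R(v))$.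
   Context: Everything is over $\mathbb{C}$. An associative conformal algebra is a $\mathbb{C}[\partial]$-module $\mathcal{T}$ with a bilinear $\lambda$-product $\mathcal{T}\otimes\mathcal{T}\to\mathcal{T}[\lambda]$, $p\otimes q\mapsto p_\lambda q$, that is conformally sesquilinear ($(\partial p)_\lambda q=-\lambda\,p_\lambda q$, $p_\lambda(\partial q)=(\partial+\lambda)(p_\lambda q)$) and satisfies $(p_\lambda q)_{\lambda+\mu}r=p_\lambda(q_\mu r)$. A conformal $\mathcal{T}$-bimodule is a $\mathbb{C}[\partial]$-module $\mathcal{U}$ with conformally sesquilinear maps $\mathcal{T}\otimes\mathcal{U}\to\mathcal{U}[\lambda]$, $(p,u)\mapsto p_\lambda u$ and $\mathcal{U}\otimes\mathcal{T}\to\mathcal{U}[\lambda]$, $(u,p)\mapsto u_\lambda p$, with $(p_\lambda u)_{\lambda+\mu}q=p_\lambda(u_\mu q)$, $(u_\lambda p)_{\lambda+\mu}q=u_\lambda(p_\mu q)$, $(p_\lambda q)_{\lambda+\mu}u=p_\lambda(q_\mu u)$. A Hochschild $2$-cocycle is a conformally sesquilinear map $H_\lambda:\mathcal{T}\otimes\mathcal{T}\to\mathcal{U}[\lambda]$ with ${p_1}_{\lambda_1}H_{\lambda_2}(p_2,p_3)-H_{\lambda_1+\lambda_2}({p_1}_{\lambda_1}p_2,p_3)+H_{\lambda_1}(p_1,{p_2}_{\lambda_2}p_3)-H_{\lambda_1}(p_1,p_2)_{\lambda_1+\lambda_2}p_3=0$. $\mathbb{C}[\partial]$-linear maps are extended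 coefficientwise to polynomials in $\lambda$. A conformal $H$-twisted Rota-Baxter operator is a $\mathbb{C}[\partial]$-linear map $R:\mathcal{U}\to\mathcal{T}$ with $R(u)_\lambda R(v)=R\big(u_\lambda R(v)+R(u)_\lambda v+H_\lambda(R(u),R(v))\big)$ for all $u,v\in\mathcal{U}$. For such $R$, the product $*_\lambda$ makes $\mathcal{U}$ an associative conformal algebra. *)

(* Defs.v *)
From HB Require Import structures.
From mathcomp Require Import all_boot all_order all_algebra.
From mathcomp Require Import finmap monalg.
From mathcomp Require Export reals complex.

Set Implicit Arguments.
Unset Strict Implicit.
Unset Printing Implicit Defensive.

Import GRing.Theory.

Local Open Scope ring_scope.

(* A C[∂]-module is an lmodType over {poly K} with K = C (e.g. K = R[i]):    *)
(* ∂ acts as the scalar 'X, and c in K as c%:P.                              *)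

(* V[λ]: finitely supported families nat -> V; << v *g i >> is v λ^i.        *)
Notation lpoly V := {malg V[nat]}.

(* V[λ, μ]: << v *g (i, j) >> is v λ^i μ^j.                                  *)
Notation lmpoly V := {malg V[(nat * nat)%type]}.

Section PolynomialsOverModules.

(* The sum of F i v over the terms v λ^i of g.                               *)
Definition lpsum (V M : zmodType) (g : lpoly V) (F : nat -> V -> M) : M :=
  \sum_(i <- msupp g) F i g@_i.

(* The coefficientwise extension V[λ] -> W[λ] of an additive map V -> W.     *)
Definition lpmap (V W : zmodType) (f : V -> W) (g : lpoly V) : lpoly W :=
  lpsum g (fun i v => << f v *g i >>).

Definition lpmulX (V : zmodType) (g : lpoly V) : lpoly V :=
  lpsum g (fun i v => << v *g i.+1 >>).

Variables V W U : zmodType.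
Variable f : V -> W -> lpoly U.

(* f_{λ+μ}(g(λ), w), from λ^i (λ+μ)^n = \sum_k 'C(n, k) λ^(i+k) μ^(n-k).     *)
Definition lpcompl (g : lpoly V) (w : W) : lmpoly U :=
  lpsum g (fun i v => lpsum (f v w) (fun n u =>
    \sum_(k < n.+1) << u *+ 'C(n, k) *g (i + k, n - k)%N >>)).

(* f_λ(v, g(μ))                                                              *)
Definition lpcompr (v : V) (g : lpoly W) : lmpoly U :=
  lpsum g (fun j w => lpsum (f v w) (fun i u => << u *g (i, j) >>)).

End PolynomialsOverModules.

Section Conformal.

Variable K : comNzRingType.

Definition partial (V : lmodType {poly K}) (v : V) : V := 'X *: v.

Record conformal_sesquilinear (V W U : lmodType {poly K})
    (f : V -> W -> lpoly U) : Prop := ConformalSesquilinear {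
  csesqDl : forall v v' w, f (v + v') w = f v w + f v' w;
  csesqDr : forall v w w', f v (w + w') = f v w + f v w';
  csesqZl : forall c v w, f (c%:P *: v) w = lpmap ( *:%R c%:P) (f v w);
  csesqZr : forall c v w, f v (c%:P *: w) = lpmap ( *:%R c%:P) (f v w);
  csesq_partiall : forall v w, f (partial v) w = - lpmulX (f v w);
  csesq_partialr : forall v w,
    f v (partial w) = lpmap (@partial U) (f v w) + lpmulX (f v w)
}.

Record assoc_conformal (T : lmodType {poly K})
    (mul : T -> T -> lpoly T) : Prop := AssocConformal {
  aconf_sesq : conformal_sesquilinear mul;
  aconfA : forall p q r, lpcompl mul (mul p q) r = lpcompr mul p (mul q r)
}.

Record conformal_bimodule (T U : lmodType {poly K})
    (mul : T -> T -> lpoly T)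
    (lact : T -> U -> lpoly U) (ract : U -> T -> lpoly U) : Prop :=
  ConformalBimodule {
  cbimod_sesql : conformal_sesquilinear lact;
  cbimod_sesqr : conformal_sesquilinear ract;
  cbimodA : forall p u q,
    lpcompl ract (lact p u) q = lpcompr lact p (ract u q);
  cbimodAr : forall u p q,
    lpcompl ract (ract u p) q = lpcompr ract u (mul p q);
  cbimodAl : forall p q u,
    lpcompl lact (mul p q) u = lpcompr lact p (lact q u)
}.

Record hochschild_2cocycle (T U : lmodType {poly K})
    (mul : T -> T -> lpoly T)
    (lact : T -> U -> lpoly U) (ract : U -> T -> lpoly U)
    (H : T -> T -> lpoly U) : Prop := Hochschild2Cocycle {
  cocycle_sesq : conformal_sesquilinear H;
  cocycleE : forall p1 p2 p3,
    lpcompr lact p1 (H p2 p3) - lpcompl H (mul p1 p2) p3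
      + lpcompr H p1 (mul p2 p3) - lpcompl ract (H p1 p2) p3 = 0
}.

Section TwistedRotaBaxter.

Variables (T U : lmodType {poly K}).
Variables (mul : T -> T -> lpoly T).
Variables (lact : T -> U -> lpoly U) (ract : U -> T -> lpoly U).
Variables (H : T -> T -> lpoly U) (rb : {linear U -> T}).

Definition rb_star (u v : U) : lpoly U :=
  ract u (rb v) + lact (rb u) v + H (rb u) (rb v).

Definition twisted_rota_baxter : Prop :=
  forall u v, mul (rb u) (rb v) = lpmap rb (rb_star u v).

Definition rb_lact (u : U) (p : T) : lpoly T :=
  mul (rb u) p - lpmap rb (ract u p + H (rb u) p).

Definition rb_ract (p : T) (u : U) : lpoly T :=
  mul p (rb u) - lpmap rb (lact p u + H p (rb u)).

End TwistedRotaBaxter.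

End Conformal.

(* Main.v *)
(* Idea: the cocycle [H] makes [E = T (+) U] an associative conformal algebra
   under [(p, u)(q, v) = (p q, p v + u q + H(p, q))], and the twisted
   Rota-Baxter identity says that the graph [G = {(R u, u)}] is a subalgebra of
   [E], isomorphic to [(U, star)].  Hence [E / G] is a bimodule over [G]; the map
   [(p, u) |-> p - R u] identifies it with [T], and the induced actions are
   [rb_lact] and [rb_ract].  The identities below are those of [E] written out
   in components, so each one reduces to the bimodule axioms and one instance of
   the cocycle equation. *)

Require Import Defs.
From mathcomp Require Import all_boot all_order all_algebra.
From mathcomp Require Import finmap monalg.

Set Implicit Arguments.
Unset Strict Implicit.
Unset Printing Implicit Defensive.

Import GRing.Theory.

Local Open Scope ring_scope.

(** * Additive maps and sums over finite supports *)

Section AdditiveMorphisms.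

Variables (V M : zmodType) (f : V -> M).
Hypothesis fD : {morph f : x y / x + y}.

Lemma morphD0 : f 0 = 0.
Proof. by apply: (addrI (f 0)); rewrite -fD !addr0. Qed.

Lemma morphDN : {morph f : x / - x}.
Proof. by move=> x; apply: (addrI (f x)); rewrite -fD !subrr morphD0. Qed.

End AdditiveMorphisms.

(** Serves the change of representative in the quotient by the graph of $R$: the two terms of [star]
    in which $R$ is applied to the representative play [y] and [z] and cancel, while [x]
    survives. *)
Lemma addr_subrACA (V : zmodType) (x y z c d : V) :
  x + y + z + (c - y + (d - z)) = c + d + x.
Proof. by rewrite (addrACA c) -opprD -(addrA x) [LHS]addrC (addrC x) addrA subrK. Qed.

(** Generalizes [lpsum], its instance at [nat], so that polynomials in $\lambda$ and in $\lambda,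
    \mu$ share the same lemmas. *)
Definition malg_sum (I : choiceType) (V M : zmodType) (g : {malg V[I]})
  (F : I -> V -> M) : M := \sum_(i <- msupp g) F i g@_i.

Section SumsOverSupports.

Variables (I : choiceType) (V M : zmodType).
Implicit Types (g h : {malg V[I]}) (F : I -> V -> M).

Lemma malg_sumEw F g (d : {fset I}) : (forall i, F i 0 = 0) ->
  (msupp g `<=` d)%fset -> malg_sum g F = \sum_(i <- d) F i g@_i.
Proof.
by move=> F0 le_gd; apply: big_fset_incl => // i _ /mcoeff_outdom ->.
Qed.

Lemma malg_sumD F : (forall i, {morph F i : x y / x + y}) ->
  {morph (fun g => malg_sum g F) : x y / x + y}.
Proof.
move=> FD g h; have F0 i := morphD0 (FD i).
(* All three sums are extended to the union of the supports of [g] and [h], since the support of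
   [g + h] may be smaller. *)
rewrite (malg_sumEw F0 (msuppD_le g h)) (malg_sumEw F0 (fsubsetUl _ (msupp h))).
rewrite (malg_sumEw F0 (fsubsetUr (msupp g) _)) -big_split /=.
by apply: eq_bigr => i _; rewrite mcoeffD FD.
Qed.

Lemma malg_sumU F i v : (forall i, F i 0 = 0) ->
  malg_sum << v *g i >> F = F i v.
Proof.
by move=> F0; rewrite (malg_sumEw F0 msuppU_le) big_seq_fset1 mcoeffUU.
Qed.

Lemma malg_sum_split F F' g :
  malg_sum g (fun i v => F i v + F' i v) = malg_sum g F + malg_sum g F'.
Proof. exact: big_split. Qed.

Lemma eq_malg_sum F F' g : (forall i v, F i v = F' i v) ->
  malg_sum g F = malg_sum g F'.
Proof. by move=> eqF; apply: eq_bigr => i _. Qed.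

Lemma malg_sum_morph (N : zmodType) (phi : M -> N) F g :
  {morph phi : x y / x + y} ->
  phi (malg_sum g F) = malg_sum g (fun i v => phi (F i v)).
Proof. by move=> phiD; apply: (big_morph phi phiD (morphD0 phiD)). Qed.

End SumsOverSupports.

(* [lpmap] is convertible to the instance [I = nat]. *)
Definition malg_map (I : choiceType) (V W : zmodType) (f : V -> W)
  (g : {malg V[I]}) : {malg W[I]} := malg_sum g (fun i v => << f v *g i >>).

(** * Coefficientwise extension of additive maps *)

Section CoefficientwiseExtension.

Variables (I : choiceType) (V W : zmodType) (f : V -> W).
Hypothesis fD : {morph f : x y / x + y}.
Implicit Types g h : {malg V[I]}.

Lemma malg_map_monoD (i : I) : {morph (fun v => << f v *g i >>) : x y / x + y}.
Proof. by move=> x y; rewrite fD monalgUD. Qed.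

Lemma malg_mapD : {morph (@malg_map I V W f) : x y / x + y}.
Proof. exact: malg_sumD malg_map_monoD. Qed.

Lemma malg_mapN : {morph (@malg_map I V W f) : x / - x}.
Proof. exact: morphDN malg_mapD. Qed.

Lemma malg_mapU (i : I) v : malg_map f << v *g i >> = << f v *g i >>.
Proof. by apply: malg_sumU => j; rewrite (morphD0 fD) monalgU0. Qed.

Lemma mcoeff_map g i : (malg_map f g)@_i = f g@_i.
Proof.
(* Both sides become sums over the support of [g], compared term by term: [f] may kill coefficients,
   so the support of the image is avoided. *)
rewrite [in RHS](monalgE g) [in RHS](big_morph _ (mcoeffD i) (mcoeff0 i)).
rewrite (big_morph _ fD (morphD0 fD)) /malg_map /malg_sum.
rewrite (big_morph _ (mcoeffD i) (mcoeff0 i)); apply: eq_bigr => k _.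
by rewrite !mcoeffU; case: eqP => // _; rewrite mulr0n (morphD0 fD).
Qed.

Lemma malg_sum_map (M : zmodType) (F : I -> W -> M) g :
  (forall i, {morph F i : x y / x + y}) ->
  malg_sum (malg_map f g) F = malg_sum g (fun i v => F i (f v)).
Proof.
move=> FD; rewrite (malg_sum_morph (fun i v => << f v *g i >>) g (malg_sumD FD)).
apply: eq_malg_sum => i v.
by apply: malg_sumU => j; apply: morphD0 (FD j).
Qed.

End CoefficientwiseExtension.

Lemma lpmapD (V W : zmodType) (f : V -> W) :
  {morph f : x y / x + y} -> {morph lpmap f : g h / g + h}.
Proof. exact: malg_mapD. Qed.

Lemma lpmapN (V W : zmodType) (f : V -> W) :
  {morph f : x y / x + y} -> {morph lpmap f : g / - g}.
Proof. exact: malg_mapN. Qed.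

Lemma mcoeff_lpmap (V W : zmodType) (f : V -> W) (g : lpoly V) i :
  {morph f : x y / x + y} -> (lpmap f g)@_i = f g@_i.
Proof. by move=> fD; apply: mcoeff_map. Qed.

(** * Multiplication by $\lambda$ as a shift of coefficients *)

Section MultiplicationByLambda.

Variable V : zmodType.
Implicit Types g h : lpoly V.

Lemma mcoeff_lpmulX g i : (lpmulX g)@_i = if i is j.+1 then g@_j else 0.
Proof.
rewrite /lpmulX /lpsum (big_morph _ (mcoeffD i) (mcoeff0 i)).
case: i => [|j]; first by apply: big1 => k _; rewrite mcoeffU.
rewrite [in RHS](monalgE g) (big_morph _ (mcoeffD j) (mcoeff0 j)).
by apply: eq_bigr => k _; rewrite !mcoeffU eqSS.
Qed.

Lemma lpmulXD : {morph @lpmulX V : g h / g + h}.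
Proof.
by move=> g h; apply/malgP => -[|i]; rewrite mcoeffD !mcoeff_lpmulX ?addr0 ?mcoeffD.
Qed.

End MultiplicationByLambda.

Lemma lpmap_lpmulX (V W : zmodType) (f : V -> W) (g : lpoly V) :
  {morph f : x y / x + y} -> lpmap f (lpmulX g) = lpmulX (lpmap f g).
Proof.
move=> fD; apply/malgP => i; rewrite mcoeff_lpmap // !mcoeff_lpmulX.
by case: i => [|i]; [rewrite (morphD0 fD) | rewrite mcoeff_lpmap].
Qed.

Definition biadditive (V W U : zmodType) (f : V -> W -> U) : Prop :=
  (forall w, {morph f^~ w : x y / x + y}) /\ (forall v, {morph f v : x y / x + y}).

(** * The two iterated products, with values in polynomials in $\lambda$ and $\mu$ *)

Section Compositions.

Variables (V W U : zmodType) (f : V -> W -> lpoly U).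
Hypothesis fB : biadditive f.

Let fDl w : {morph f^~ w : x y / x + y} := fB.1 w.
Let fDr v : {morph f v : x y / x + y} := fB.2 v.

Lemma lpcompl_monoD i n :
  {morph (fun u : U => \sum_(k < n.+1) << u *+ 'C(n, k) *g (i + k, n - k)%N >>)
    : x y / x + y}.
Proof.
by move=> x y; rewrite -big_split /=; apply: eq_bigr => k _; rewrite mulrnDl monalgUD.
Qed.

Lemma lpcompr_monoD (j i : nat) :
  {morph (fun u : U => << u *g (i, j) >>) : x y / x + y}.
Proof. exact: monalgUD. Qed.

Lemma lpcomplD w : {morph (lpcompl f)^~ w : g h / g + h}.
Proof.
apply: malg_sumD => i x y; rewrite fDl.
exact: (malg_sumD (lpcompl_monoD i)).
Qed.

Lemma lpcomplN w : {morph (lpcompl f)^~ w : g / - g}.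
Proof. exact: morphDN (lpcomplD w). Qed.

Lemma lpcomprD v : {morph lpcompr f v : g h / g + h}.
Proof.
apply: malg_sumD => j x y; rewrite fDr.
exact: (malg_sumD (lpcompr_monoD j)).
Qed.

Lemma lpcomprN v : {morph lpcompr f v : g / - g}.
Proof. exact: morphDN (lpcomprD v). Qed.

Lemma lpcompl_map (V' : zmodType) (a : V' -> V) g w :
  lpcompl f (lpmap a g) w = lpcompl (fun v => f (a v)) g w.
Proof.
rewrite /lpcompl [LHS]malg_sum_map // => i x y; rewrite fDl.
exact: (malg_sumD (lpcompl_monoD i)).
Qed.

Lemma lpcompr_map (W' : zmodType) (a : W' -> W) v g :
  lpcompr f v (lpmap a g) = lpcompr (fun v w => f v (a w)) v g.
Proof.
rewrite /lpcompr [LHS]malg_sum_map // => j x y; rewrite fDr.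
exact: (malg_sumD (lpcompr_monoD j)).
Qed.

Lemma lpcompl_addf (f' : V -> W -> lpoly U) g w :
  lpcompl (fun v w => f v w + f' v w) g w = lpcompl f g w + lpcompl f' g w.
Proof.
rewrite /lpcompl -[RHS]malg_sum_split; apply: eq_malg_sum => i v.
exact: (malg_sumD (lpcompl_monoD i)).
Qed.

Lemma lpcompr_addf (f' : V -> W -> lpoly U) v g :
  lpcompr (fun v w => f v w + f' v w) v g = lpcompr f v g + lpcompr f' v g.
Proof.
rewrite /lpcompr -[RHS]malg_sum_split; apply: eq_malg_sum => i w.
exact: (malg_sumD (lpcompr_monoD i)).
Qed.

End Compositions.

Section PostComposition.

Variables (V W U U' : zmodType) (f : V -> W -> lpoly U) (a : U -> U').
Hypothesis aD : {morph a : x y / x + y}.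

Lemma lpcompl_post g w :
  lpcompl (fun v w => lpmap a (f v w)) g w = malg_map a (lpcompl f g w).
Proof.
rewrite /lpcompl [RHS](malg_sum_morph _ _ (malg_mapD aD)).
apply: eq_malg_sum => i v; rewrite [RHS](malg_sum_morph _ _ (malg_mapD aD)).
rewrite [LHS]malg_sum_map => [|n]; last exact: lpcompl_monoD.
apply: eq_malg_sum => n u.
rewrite (big_morph _ (malg_mapD aD) (morphD0 (malg_mapD aD))).
apply: eq_bigr => k _; rewrite malg_mapU //.
(* An additive map commutes with the integer multiples coming from the expansion of
   $(\lambda+\mu)^n$. *)
elim: 'C(n, k) => [|m IHm]; first by rewrite !mulr0n (morphD0 aD).
by rewrite !mulrS aD !monalgUD IHm.
Qed.

Lemma lpcompr_post v g :
  lpcompr (fun v w => lpmap a (f v w)) v g = malg_map a (lpcompr f v g).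
Proof.
rewrite /lpcompr [RHS](malg_sum_morph _ _ (malg_mapD aD)).
apply: eq_malg_sum => j w; rewrite [RHS](malg_sum_morph _ _ (malg_mapD aD)).
rewrite [LHS]malg_sum_map => [|n]; last exact: lpcompr_monoD.
by apply: eq_malg_sum => i u; rewrite malg_mapU.
Qed.

End PostComposition.

(** * Compositions of maps having the common shape of $\mathfrak{l}^R$ and $\mathfrak{r}^R$ *)

Section SubPostComposition.

Variables (V W U U' : zmodType) (f0 : V -> W -> lpoly U').
Variables (f f1 : V -> W -> lpoly U) (a : U -> U').
Hypothesis aD : {morph a : x y / x + y}.

Lemma lpcompl_sub_post g w :
  lpcompl (fun v w => f0 v w - lpmap a (f v w + f1 v w)) g w =
  lpcompl f0 g w - malg_map a (lpcompl f g w + lpcompl f1 g w).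
Proof.
rewrite -lpcompl_addf -lpcompl_post //; apply/esym/eqP.
(* Moving the subtracted term across reduces the claim to the rule for sums. *)
by rewrite subr_eq -lpcompl_addf; apply/eqP/eq_malg_sum => i v; rewrite subrK.
Qed.

Lemma lpcompr_sub_post v g :
  lpcompr (fun v w => f0 v w - lpmap a (f v w + f1 v w)) v g =
  lpcompr f0 v g - malg_map a (lpcompr f v g + lpcompr f1 v g).
Proof.
rewrite -lpcompr_addf -lpcompr_post //; apply/esym/eqP.
by rewrite subr_eq -lpcompr_addf; apply/eqP/eq_malg_sum => i w; rewrite subrK.
Qed.

End SubPostComposition.

(** * Closure properties of conformally sesquilinear maps, from which [star] and both actions are
    built *)

Section Sesquilinearity.

Variable K : comNzRingType.
Implicit Types V W U : lmodType {poly K}.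

Lemma conformal_sesquilinear_biadditive V W U (f : V -> W -> lpoly U) :
  conformal_sesquilinear f -> biadditive f.
Proof. by case=> fDl fDr *; split=> ? ? ?; [apply: fDl | apply: fDr]. Qed.

Let scaleD U (c : {poly K}) : {morph *:%R c : x y / x + y :> U} := scalerDr c.

Let partialD U : {morph @partial K U : x y / x + y} := scalerDr 'X.

Lemma conformal_sesquilinearD V W U (f g : V -> W -> lpoly U) :
  conformal_sesquilinear f -> conformal_sesquilinear g ->
  conformal_sesquilinear (fun v w => f v w + g v w).
Proof.
case=> fDl fDr fZl fZr fdl fdr [gDl gDr gZl gZr gdl gdr].
split=> [v v' w|v w w'|c v w|c v w|v w|v w].
- by rewrite fDl gDl addrACA.
- by rewrite fDr gDr addrACA.
- by rewrite fZl gZl (lpmapD (@scaleD U _)).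
- by rewrite fZr gZr (lpmapD (@scaleD U _)).
- by rewrite fdl gdl lpmulXD opprD.
- by rewrite fdr gdr lpmulXD (lpmapD (@partialD U)) addrACA.
Qed.

Lemma conformal_sesquilinearN V W U (f : V -> W -> lpoly U) :
  conformal_sesquilinear f -> conformal_sesquilinear (fun v w => - f v w).
Proof.
case=> fDl fDr fZl fZr fdl fdr.
split=> [v v' w|v w w'|c v w|c v w|v w|v w].
- by rewrite fDl opprD.
- by rewrite fDr opprD.
- by rewrite fZl (lpmapN (@scaleD U _)).
- by rewrite fZr (lpmapN (@scaleD U _)).
- by rewrite fdl (morphDN (@lpmulXD U)).
- by rewrite fdr (morphDN (@lpmulXD U)) (lpmapN (@partialD U)) opprD.
Qed.

Lemma conformal_sesquilinear_prel V V' W U (f : V -> W -> lpoly U)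
    (a : {linear V' -> V}) :
  conformal_sesquilinear f -> conformal_sesquilinear (fun v w => f (a v) w).
Proof.
case=> fDl fDr fZl fZr fdl fdr.
split=> [v v' w|v w w'|c v w|c v w|v w|v w].
- by rewrite linearD fDl.
- exact: fDr.
- by rewrite linearZ fZl.
- exact: fZr.
- by rewrite /partial linearZ -/(partial (a v)) fdl.
- exact: fdr.
Qed.

Lemma conformal_sesquilinear_prer V W W' U (f : V -> W -> lpoly U)
    (a : {linear W' -> W}) :
  conformal_sesquilinear f -> conformal_sesquilinear (fun v w => f v (a w)).
Proof.
case=> fDl fDr fZl fZr fdl fdr.
split=> [v v' w|v w w'|c v w|c v w|v w|v w].
- exact: fDl.
- by rewrite linearD fDr.
- exact: fZl.
- by rewrite linearZ fZr.
- exact: fdl.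
- by rewrite {1}/partial linearZ -/(partial (a w)) fdr.
Qed.

Lemma conformal_sesquilinear_post V W U U' (f : V -> W -> lpoly U)
    (a : {linear U -> U'}) :
  conformal_sesquilinear f ->
  conformal_sesquilinear (fun v w => lpmap a (f v w)).
Proof.
case=> fDl fDr fZl fZr fdl fdr; have aD : {morph a : x y / x + y} := linearD a.
(* Here [c] is any scalar in [{poly K}]: constants give the scaling axioms, and ['X] gives
   compatibility with $\partial$. *)
have aZ c g : lpmap a (lpmap ( *:%R c) g) = lpmap ( *:%R c) (lpmap a g).
  apply/malgP => i; rewrite !mcoeff_lpmap ?linearZ //; exact: scaleD.
split=> [v v' w|v w w'|c v w|c v w|v w|v w].
- by rewrite fDl (lpmapD aD).
- by rewrite fDr (lpmapD aD).
- by rewrite fZl aZ.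
- by rewrite fZr aZ.
- by rewrite fdl (lpmapN aD) -lpmap_lpmulX.
- by rewrite fdr (lpmapD aD) -lpmap_lpmulX // (aZ 'X).
Qed.

End Sesquilinearity.

(** * The product [star] and the induced actions on $\mathcal{T}$ *)

Section TwistedRotaBaxterBimodule.

Variables (K : comNzRingType) (T U : lmodType {poly K}).
Variables (mul : T -> T -> lpoly T).
Variables (lact : T -> U -> lpoly U) (ract : U -> T -> lpoly U).
Variables (H : T -> T -> lpoly U) (rb : {linear U -> T}).

Hypothesis mulA : assoc_conformal mul.
Hypothesis bimod : conformal_bimodule mul lact ract.
Hypothesis cocycle : hochschild_2cocycle mul lact ract H.
Hypothesis rbP : twisted_rota_baxter mul lact ract H rb.

Local Notation star := (rb_star lact ract H rb).
Local Notation rbl := (rb_lact mul ract H rb).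
Local Notation rbr := (rb_ract mul lact H rb).
Local Notation rb2 := (@malg_map (nat * nat)%type _ _ rb).

Let mulB := conformal_sesquilinear_biadditive (aconf_sesq mulA).
Let lactB := conformal_sesquilinear_biadditive (cbimod_sesql bimod).
Let ractB := conformal_sesquilinear_biadditive (cbimod_sesqr bimod).
Let HB := conformal_sesquilinear_biadditive (cocycle_sesq cocycle).
Let rbD : {morph rb : x y / x + y} := linearD rb.

(** The cocycle equation without signs: the $\mathcal{U}$-component of associativity in $E$ for
    $(p_1,0)$, $(p_2,0)$, $(p_3,0)$. *)
Lemma cocycle_compl p1 p2 p3 :
  lpcompl H (mul p1 p2) p3 + lpcompl ract (H p1 p2) p3 =
  lpcompr lact p1 (H p2 p3) + lpcompr H p1 (mul p2 p3).
Proof.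
apply/esym/eqP; rewrite -subr_eq0 opprD addrA; apply/eqP.
by rewrite -[RHS](cocycleE cocycle p1 p2 p3) (addrAC (lpcompr _ _ _)).
Qed.

Lemma lpcompl_rb_star g w :
  lpcompl star g w = lpcompl ract g (rb w) + lpcompl lact (lpmap rb g) w
                     + lpcompl H (lpmap rb g) (rb w).
Proof. by rewrite !lpcompl_map // [LHS]lpcompl_addf lpcompl_addf. Qed.

Lemma lpcompr_rb_star u g :
  lpcompr star u g = lpcompr ract u (lpmap rb g) + lpcompr lact (rb u) g
                     + lpcompr H (rb u) (lpmap rb g).
Proof. by rewrite !lpcompr_map // [LHS]lpcompr_addf lpcompr_addf. Qed.

Lemma lpcompl_rb_lact g p :
  lpcompl rbl g p =
  lpcompl mul (lpmap rb g) p - rb2 (lpcompl ract g p + lpcompl H (lpmap rb g) p).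
Proof.
rewrite !lpcompl_map //.
exact: (lpcompl_sub_post (fun u => mul (rb u)) ract (fun u => H (rb u)) rbD).
Qed.

Lemma lpcompr_rb_lact u g :
  lpcompr rbl u g =
  lpcompr mul (rb u) g - rb2 (lpcompr ract u g + lpcompr H (rb u) g).
Proof.
exact: (lpcompr_sub_post (fun u => mul (rb u)) ract (fun u => H (rb u)) rbD).
Qed.

Lemma lpcompl_rb_ract g u :
  lpcompl rbr g u =
  lpcompl mul g (rb u) - rb2 (lpcompl lact g u + lpcompl H g (rb u)).
Proof.
exact: (lpcompl_sub_post (fun p u => mul p (rb u)) lact (fun p u => H p (rb u)) rbD).
Qed.

Lemma lpcompr_rb_ract p g :
  lpcompr rbr p g =
  lpcompr mul p (lpmap rb g) - rb2 (lpcompr lact p g + lpcompr H p (lpmap rb g)).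
Proof.
rewrite !lpcompr_map //.
exact: (lpcompr_sub_post (fun p u => mul p (rb u)) lact (fun p u => H p (rb u)) rbD).
Qed.

Lemma lpcompl_mul_rb g v :
  lpcompl mul (lpmap rb g) (rb v) = rb2 (lpcompl star g v).
Proof.
rewrite lpcompl_map // -lpcompl_post //.
(* The twisted Rota-Baxter identity is applied to each coefficient [u] of [g]. *)
apply: eq_malg_sum => i u; exact: (congr1 (fun h => lpsum h _) (rbP u v)).
Qed.

Lemma lpcompr_mul_rb u g :
  lpcompr mul (rb u) (lpmap rb g) = rb2 (lpcompr star u g).
Proof.
rewrite lpcompr_map // -lpcompr_post //.
apply: eq_malg_sum => i v; exact: (congr1 (fun h => lpsum h _) (rbP u v)).
Qed.

Lemma rb_star_sesquilinear : conformal_sesquilinear star.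
Proof.
apply: conformal_sesquilinearD; first apply: conformal_sesquilinearD.
- exact: conformal_sesquilinear_prer (cbimod_sesqr bimod).
- exact: conformal_sesquilinear_prel (cbimod_sesql bimod).
- apply: (@conformal_sesquilinear_prel _ _ _ _ _ (fun p u => H p (rb u))).
  exact: conformal_sesquilinear_prer (cocycle_sesq cocycle).
Qed.

Lemma rb_lact_sesquilinear : conformal_sesquilinear rbl.
Proof.
apply: conformal_sesquilinearD.
  exact: conformal_sesquilinear_prel (aconf_sesq mulA).
apply/conformal_sesquilinearN/conformal_sesquilinear_post.
apply: conformal_sesquilinearD (cbimod_sesqr bimod) _.
exact: conformal_sesquilinear_prel (cocycle_sesq cocycle).
Qed.

Lemma rb_ract_sesquilinear : conformal_sesquilinear rbr.
Proof.
apply: conformal_sesquilinearD.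
  exact: conformal_sesquilinear_prer (aconf_sesq mulA).
apply/conformal_sesquilinearN/conformal_sesquilinear_post.
apply: conformal_sesquilinearD (cbimod_sesql bimod) _.
exact: conformal_sesquilinear_prer (cocycle_sesq cocycle).
Qed.

(** Once $R(u*v)$ is replaced by $R(u)R(v)$, each of the three bimodule axioms matches one pair of
    terms, and the four terms in [H] are the cocycle equation at $(R(u), R(v), R(w))$. *)
Lemma rb_star_assoc_conformal : assoc_conformal star.
Proof.
split=> [|u v w]; first exact: rb_star_sesquilinear.
rewrite lpcompl_rb_star lpcompr_rb_star -!rbP /rb_star.
rewrite !(lpcomplD ractB) !(lpcomprD lactB).
rewrite (cbimodAr bimod) (cbimodA bimod) (cbimodAl bimod).
rewrite -!addrA; do 2 congr (_ + _).
(* The term in [w] is moved out of the way to bring the two left-hand terms in [H] together. *)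
rewrite addrCA [in LHS](addrC (lpcompl ract _ _)) cocycle_compl.
by rewrite !addrA.
Qed.

(* The left (resp. right) action of [G] on [E / G] applied to a representative
   [(g, X)] of [g - R X] other than [(g - R X, 0)]. *)
Lemma lpcompr_rb_lact_sub u g X :
  lpcompr rbl u (g - lpmap rb X) =
  lpcompr mul (rb u) g
  - rb2 (lpcompr ract u g + lpcompr H (rb u) g + lpcompr lact (rb u) X).
Proof.
rewrite lpcompr_rb_lact (lpcomprD mulB) (lpcomprN mulB) (lpcomprD ractB).
rewrite (lpcomprN ractB) (lpcomprD HB) (lpcomprN HB) lpcompr_mul_rb.
rewrite lpcompr_rb_star -addrA -opprD -(malg_mapD rbD).
congr (_ - malg_map _ _).
by rewrite (addrC (lpcompr ract u (lpmap rb X))) addr_subrACA.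
Qed.

Lemma lpcompl_rb_ract_sub g X v :
  lpcompl rbr (g - lpmap rb X) v =
  lpcompl mul g (rb v)
  - rb2 (lpcompl lact g v + lpcompl H g (rb v) + lpcompl ract X (rb v)).
Proof.
rewrite lpcompl_rb_ract (lpcomplD mulB) (lpcomplN mulB) (lpcomplD lactB).
rewrite (lpcomplN lactB) (lpcomplD HB) (lpcomplN HB) lpcompl_mul_rb.
rewrite lpcompl_rb_star -addrA -opprD -(malg_mapD rbD).
congr (_ - malg_map _ _).
exact: addr_subrACA.
Qed.

(** By definition [rbl v p] is $g - R(X)$ with $g = R(v)p$ and $X = vp + H(R(v),p)$, so both sides
    become a triple product minus a value of $R$. The products agree by associativity, the arguments
    of $R$ by two bimodule axioms and the cocycle equation at $(R(u), R(v), p)$. *)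
Lemma rb_lactA u v p : lpcompl rbl (star u v) p = lpcompr rbl u (rbl v p).
Proof.
rewrite lpcompr_rb_lact_sub lpcompl_rb_lact -rbP (aconfA mulA).
congr (_ - malg_map _ _).
rewrite !(lpcomplD ractB) (lpcomprD lactB) (cbimodAr bimod) (cbimodA bimod).
rewrite -[LHS]addrA (addrC (lpcompl ract _ _)) cocycle_compl -addrA -[RHS]addrA.
by rewrite [X in _ = _ + X]addrC -!addrA.
Qed.

(** The same comparison, with a change of representative on both sides and the cocycle equation at
    $(R(u), p, R(v))$. *)
Lemma rb_lact_ractA u p v : lpcompl rbr (rbl u p) v = lpcompr rbl u (rbr p v).
Proof.
rewrite lpcompl_rb_ract_sub lpcompr_rb_lact_sub (aconfA mulA).
congr (_ - malg_map _ _).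
rewrite (lpcomplD ractB) (lpcomprD lactB) (cbimodAr bimod) (cbimodAl bimod).
rewrite addrACA cocycle_compl.
by rewrite addrACA [LHS]addrC addrA.
Qed.

(** Mirror image of the left action, with the cocycle equation at $(p, R(u), R(v))$. *)
Lemma rb_ractA p u v : lpcompl rbr (rbr p u) v = lpcompr rbr p (star u v).
Proof.
rewrite lpcompl_rb_ract_sub lpcompr_rb_ract -rbP (aconfA mulA).
congr (_ - malg_map _ _).
rewrite (lpcomplD ractB) !(lpcomprD lactB) (cbimodA bimod) (cbimodAl bimod).
by rewrite addrACA cocycle_compl (addrC (lpcompr lact _ _)) addrA.
Qed.

Lemma rb_conformal_bimodule : conformal_bimodule star rbl rbr.
Proof.
split.
- exact: rb_lact_sesquilinear.
- exact: rb_ract_sesquilinear.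
- exact: rb_lact_ractA.
- exact: rb_ractA.
- exact: rb_lactA.
Qed.

End TwistedRotaBaxterBimodule.

(** Associativity of [star] is part of the conclusion because [conformal_bimodule] does not itself
    assert that the acting product is associative. *)
Theorem proposition3p3 (R : realType) (T U : lmodType {poly R[i]})
    (mul : T -> T -> lpoly T)
    (lact : T -> U -> lpoly U) (ract : U -> T -> lpoly U)
    (H : T -> T -> lpoly U) (rb : {linear U -> T}) :
  assoc_conformal mul ->
  conformal_bimodule mul lact ract ->
  hochschild_2cocycle mul lact ract H ->
  twisted_rota_baxter mul lact ract H rb ->
  assoc_conformal (rb_star lact ract H rb) /\
  conformal_bimodule (rb_star lact ract H rb)
    (rb_lact mul ract H rb) (rb_ract mul lact H rb).
Proof.
move=> mulA bimod cocycle rbP; split.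
  exact: rb_star_assoc_conformal bimod cocycle rbP.
exact: rb_conformal_bimodule mulA bimod cocycle rbP.
Qed.
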